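(* Let $X$ be a Banach space, $Q$ a compact subset of $X$ with relative boundary $\partial Q$, and $S$ a closed subset of $X$ such that $S$ and $\partial Q$ link. Let $f:X\to\mathbb{R}$ be a $\mathcal{C}^1$ functional and set $$E=\{\gamma\in\mathcal{C}(Q,X):\ \gamma|_{\partial Q}=\mathrm{Id}\},\qquad c=\inf_{\gamma\in E}\max_{x\in Q}f(\gamma(x)),$$ $$c_0=\inf_S f,\qquad d=\max_{\partial Q}f.$$ Suppose that $c_0\ge d$. Then $f$ admits a sequence of ''almost critical'' points $(u_n)_n\subset X$, that is, $f(u_n)\to c$ and $f'(u_n)\to 0$. In the case $c=c_0$ (in this case $c=c_0=d$), one has the following information on the location of these points: for each $\varepsilon$ with $0<\varepsilon<\frac{\max\{1,\operatorname{dist}(\partial Q,S)\}}{2}$, there exists $x_\varepsilon\in X$ such that (i) $c\le f(x_\varepsilon)\le c+\frac54\varepsilon^2$, (ii) $\operatorname{dist}(x_\varepsilon,S)\le\frac32\varepsilon$, and (iii) $\|f'(x_\varepsilon)\|\le\frac{\varepsilon}{2}$.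
   Context: $\partial Q$ denotes the relative boundary of $Q$. For example, if $X=V_1\oplus V_2$ with $V_1,V_2$ closed subspaces, $\dim V_2<\infty$, and $Q=B_R(0)\cap V_2$, where $B_R(0)$ is the ball of radius $R$ about $0$, then the relative boundary is $\partial Q=\{u\in V_2:\ \|u\|=R\}$. Linking: a closed set $S\subset X$ and $\partial Q$ link if $S\cap\partial Q=\varnothing$ and, for every continuous $\gamma:X\to X$ with $\gamma|_{\partial Q}=\mathrm{Id}$, one has $\gamma(Q)\cap S\neq\varnothing$. $\mathcal{C}(Q,X)$ is the set of continuous maps from $Q$ to $X$; $\operatorname{dist}$ is the distance induced by the norm of $X$; $f'(x)$ is the derivative of $f$ at $x$, and $\|f'(x)\|$ is its norm in the dual space $X^*$.
   Formalization: The parenthetical ''in this case c = c_0 = d'' is dropped because it is false (X = R, Q = [-1,1], S = {0}, f(x) = 1 - x^2 gives c = c_0 = 1, d = 0); the location statement is proved under c = c_0 alone. *)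

(* Defs.v *)
From HB Require Import structures.
From mathcomp Require Import all_boot all_order all_algebra.
From mathcomp Require Import all_classical all_reals all_analysis.

Set Implicit Arguments.
Unset Strict Implicit.
Unset Printing Implicit Defensive.

Import Order.TTheory GRing.Theory Num.Theory.
Import numFieldNormedType.Exports.

Local Open Scope classical_set_scope.
Local Open Scope ring_scope.

Definition affine_hull (R : realType) (X : normedModType R) (A : set X) : set X :=
  [set x | exists (n : nat) (a : 'I_n -> R) (v : 'I_n -> X),
     [/\ forall i, A (v i), \sum_(i < n) a i = 1
       & x = \sum_(i < n) a i *: v i]].

(* Interior and boundary are relative to the affine hull. For Q the closed ball
   of radius r > 0 of a finite-dimensional subspace V, the hull is V and the
   relative boundary is the sphere of radius r in V. *)
Definition relative_interior (R : realType) (X : normedModType R) (Q : set X) :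
    set X :=
  [set x | Q x /\ within (affine_hull Q) (nbhs x) Q].

Definition relative_boundary (R : realType) (X : normedModType R) (Q : set X) :
    set X :=
  closure Q `\` relative_interior Q.

Definition links (R : realType) (X : normedModType R) (S Q : set X) : Prop :=
  S `&` relative_boundary Q = set0 /\
  forall g : X -> X, continuous g ->
    (forall x, relative_boundary Q x -> g x = x) ->
    (g @` Q) `&` S !=set0.

(* A map Q -> X is represented by a total function of which only the values
   on Q matter. *)
Definition admissible (R : realType) (X : normedModType R) (Q : set X) :
    set (X -> X) :=
  [set g | {within Q, continuous g} /\
           forall x, relative_boundary Q x -> g x = x].

(* Infima and suprema of f are taken in \bar R, so that an infimum over a set on
   which f is unbounded below is -oo instead of a default real value. On a
   nonempty compact set the supremum of a continuous function is its maximum. *)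
Definition inf_on (R : realType) (X : normedModType R) (f : X -> R) (A : set X) :
    \bar R :=
  ereal_inf [set (f x)%:E | x in A].

Definition sup_on (R : realType) (X : normedModType R) (f : X -> R) (A : set X) :
    \bar R :=
  ereal_sup [set (f x)%:E | x in A].

Definition minimax (R : realType) (X : normedModType R) (f : X -> R)
    (Q : set X) : \bar R :=
  ereal_inf [set sup_on (f \o g) Q | g in admissible Q].

(* It is finite exactly on the bounded functionals. *)
Definition dual_norm (R : realType) (X : normedModType R) (l : X -> R) : \bar R :=
  ereal_sup [set `|l h|%:E | h in [set h : X | `|h| <= 1]].

Definition C1_functional (R : realType) (X : normedModType R) (f : X -> R) :
    Prop :=
  (forall x, differentiable f x) /\
  (forall x, dual_norm ('d f y \- 'd f x) @[y --> x] --> 0%E).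

Definition set_dist (R : realType) (X : normedModType R) (A B : set X) : \bar R :=
  ereal_inf [set edist_inf B x | x in A].

(* Main.v *)
(* If c = c0, put T = S; if c0 < c, the superlevel set {f >= c} also meets the
   image of every admissible map, and serves as T. In both cases T is closed,
   disjoint from the boundary, and f >= c on T. Perturb f by
   psi(x) = max(0, a (a - dist(x, T))), so that the maximum of f + psi over any
   path is at least c + a^2, while it is at most c + a^2 + a^2/2 for a nearly
   optimal path g0. Ekeland's principle, run in the form of the Brezis-Browder
   ordering principle on pairs (g, M) with f + psi <= M on g(Q), yields a path g
   near g0, frozen where g0 is far from T, whose level cannot be lowered at rate
   a. If ||f'|| > 2a held at all the points of g(Q) at level M, gluing descent
   directions with a partition of unity would lower that level at rate a. *)

Require Import Defs.
From HB Require Import structures.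
From mathcomp Require Import all_boot all_order all_algebra.
From mathcomp Require Import all_classical all_reals all_analysis.
From mathcomp Require Import finmap ring lra.

Set Implicit Arguments.
Unset Strict Implicit.
Unset Printing Implicit Defensive.

Import Order.TTheory GRing.Theory Num.Theory.
Import numFieldNormedType.Exports.

Local Open Scope classical_set_scope.
Local Open Scope ring_scope.

(** * Distance to a set *)

Section distance_to_set.
Context {R : realType} {X : normedModType R}.
Implicit Types (A : set X) (x y : X).

(** Real-valued, for use in real arithmetic. On the empty set the infimum takes the default value 0,
    so positivity off [A] can hold only for nonempty [A]. *)
Definition infdist A x : R := inf [set `|x - a| | a in A].

Let lbound0 A x : lbound [set `|x - a| | a in A] 0.
Proof. by move=> _ [a _ <-]. Qed.

Lemma infdist_ge0 A x : 0 <= infdist A x.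
Proof.
have [->|/set0P[a Aa]] := eqVneq A set0.
  by rewrite /infdist image_set0 inf0.
by apply: lb_le_inf; [exists `|x - a|, a|exact: lbound0].
Qed.

Lemma infdist_le A x a : A a -> infdist A x <= `|x - a|.
Proof. by move=> Aa; apply: ge_inf; [exists 0; exact: lbound0|exists a]. Qed.

Lemma infdist_lt A x e : A !=set0 -> infdist A x < e ->
  exists2 a, A a & `|x - a| < e.
Proof.
move=> [a Aa] xe; have e0 : 0 < e - infdist A x by rewrite subr_gt0.
have [|_ [b Ab <-]] := inf_adherent e0 (_ : has_inf [set `|x - a| | a in A]).
  by split; [exists `|x - a|, a|exists 0; exact: lbound0].
by rewrite -/(infdist A x) subrKC; exists b.
Qed.

Lemma infdist0 A a : A a -> infdist A a = 0.
Proof.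
move=> Aa; apply/eqP; rewrite eq_le infdist_ge0 andbT.
by have := infdist_le a Aa; rewrite subrr normr0.
Qed.

Lemma infdist_lipschitz A x y : `|infdist A x - infdist A y| <= `|x - y|.
Proof.
have [->|/set0P[a Aa]] := eqVneq A set0.
  by rewrite /infdist !image_set0 subrr normr0.
suff dist_le u v : infdist A u <= infdist A v + `|u - v|.
  by rewrite ler_distl lerBlDr dist_le /= distrC dist_le.
rewrite -lerBlDr; apply: lb_le_inf; first by exists `|v - a|, a.
move=> _ [b Ab <-]; rewrite lerBlDr addrC (le_trans (infdist_le u Ab))//.
exact: ler_distD.
Qed.

Lemma infdist_continuous A : continuous (infdist A).
Proof.
move=> x; apply/cvgrPdist_lt => e e0; near=> y.
apply: le_lt_trans (infdist_lipschitz _ _ _) _.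
by near: y; exact: cvgr_dist_lt.
Unshelve. all: by end_near. Qed.

Lemma infdist_gt0 A x : closed A -> A !=set0 -> ~ A x -> 0 < infdist A x.
Proof.
move=> cA A0 nAx; rewrite lt_neqAle infdist_ge0 andbT eq_sym.
apply/eqP => d0; apply/nAx/cA => V /nbhs_ballP[e /= e0 eV].
have [|a Aa xa] := @infdist_lt A x e A0; first by rewrite d0.
by exists a; split => //; apply: eV; rewrite -ball_normE.
Qed.

End distance_to_set.

(** * Convex sets and gluing by partitions of unity *)

Definition segment_closed (R : realType) (X : normedModType R) (C : set X) :=
  forall (a b : X) (t : R), C a -> C b -> 0 <= t <= 1 ->
  C (t *: a + (1 - t) *: b).

Section gluing.
Context {R : realType} {X : normedModType R}.

(** Induction on the list: with [S] the weight of the tail, the mean is the point of parameter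
    [p x / (p x + S)] on the segment from the tail mean to [v x]. Zero weights are split off, since
    [v] is not controlled there. *)
Lemma segment_closed_mean (C : set X) (s : seq X) (p : X -> R) (v : X -> X) :
    segment_closed C -> (forall x, x \in s -> 0 <= p x) ->
    (forall x, x \in s -> 0 < p x -> C (v x)) ->
    0 < \sum_(x <- s) p x ->
  C ((\sum_(x <- s) p x)^-1 *: \sum_(x <- s) p x *: v x).
Proof.
move=> cC; elim: s => [|x s IH] p0 Cv; first by rewrite big_nil ltxx.
rewrite !big_cons.
have p0s y : y \in s -> 0 <= p y by move=> ys; rewrite p0// inE ys orbT.
have Cvs y : y \in s -> 0 < p y -> C (v y).
  by move=> ys; apply: Cv; rewrite inE ys orbT.
have sum0 : 0 <= \sum_(y <- s) p y.
  by rewrite big_seq; apply: sumr_ge0 => y /p0s.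
have px0 : 0 <= p x by rewrite p0// inE eqxx.
have [sum_eq0 pos|sum_neq0] := eqVneq (\sum_(y <- s) p y) 0.
  move: pos; rewrite sum_eq0 addr0 => pos.
  rewrite big_seq big1 ?addr0; last first.
    move=> y ys; move/eqP: sum_eq0; rewrite big_seq psumr_eq0; last exact: p0s.
    by move=> /allP/(_ y ys); rewrite ys => /eqP ->; rewrite scale0r.
  by rewrite scalerA mulVf ?gt_eqF// scale1r; apply: Cv; rewrite ?inE ?eqxx.
have {sum_neq0}spos : 0 < \sum_(y <- s) p y.
  by rewrite lt_neqAle eq_sym sum_neq0.
have Cs := IH p0s Cvs spos.
have [px_eq0|px_neq0] := eqVneq (p x) 0; first by rewrite px_eq0 scale0r !add0r.
have {px_neq0}pxpos : 0 < p x by rewrite lt_neqAle eq_sym px_neq0.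
move=> pos; set S := \sum_(y <- s) p y in sum0 spos Cs pos *.
have -> : (p x + S)^-1 *: (p x *: v x + \sum_(y <- s) p y *: v y) =
    (p x / (p x + S)) *: v x +
    (1 - p x / (p x + S)) *: (S^-1 *: \sum_(y <- s) p y *: v y).
  rewrite scalerDr !scalerA; congr (_ *: _ + _ *: _); first by rewrite mulrC.
  by field; rewrite !gt_eqF.
apply: cC => //; first by apply: Cv; rewrite ?inE ?eqxx.
by rewrite divr_ge0 ?(ltW pos)//= ler_pdivrMr// mul1r lerDl.
Qed.

(** Finitely many balls contained in the sets [U x] cover [Q]. Weighting [v x] by a tent function on
    its ball makes [g y] a convex combination of values [v x] with [U x y], so each property wanted
    of [g y] can be tested on a convex set [C] that may depend on [y]. *)
Lemma compact_gluing (Q : set X) (U : X -> set X) (v : X -> X) :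
    compact Q -> (forall x, Q x -> nbhs x (U x)) ->
  exists g : X -> X, continuous g /\
    forall y (C : set X), Q y -> segment_closed C ->
      (forall x, Q x -> U x y -> C (v x)) -> C (g y).
Proof.
(* The empty set is treated apart: there [infdist] is 0 and [den] below would vanish. *)
move=> cQ nU; have [->|/set0P Q0] := eqVneq Q set0.
  by exists (fun=> 0); split => // x; exact: cvg_cst.
have /choice[r rU] : forall x, exists r : R, Q x ->
    0 < r /\ forall y, `|x - y| < r -> U x y.
  move=> x; have [Qx|nQx] := pselect (Q x); last by exists 0.
  have /nbhs_ballP[e /= e0 eU] := nU _ Qx; exists e => _; split => // y xy.
  by apply: eU; rewrite -ball_normE.
have [D DQ Qcov] : finite_subset_cover Q (fun x => ball x (r x)) Q.
  move: cQ; rewrite compact_cover; apply => [x _|x Qx]; first exact: ball_open.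
  by exists x => //; apply: ballxx; have [] := rU _ Qx.
have {}DQ x : x \in D -> Q x by move=> /DQ/set_mem.
pose p x y : R := Num.max 0 (r x - `|x - y|).
have p_cont x : continuous (p x).
  move=> y; apply: (@continuous_max _ _ (fun=> 0) (fun z => r x - `|x - z|)).
    exact: cvg_cst.
  apply: cvgB; first exact: cvg_cst.
  by apply: cvg_norm; apply: cvgB; [exact: cvg_cst|exact: cvg_id].
have p_ge0 x y : 0 <= p x y by rewrite le_max lexx.
have sum_ge0 y : 0 <= \sum_(x <- D) p x y by exact: sumr_ge0.
have sum_gt0 y : Q y -> 0 < \sum_(x <- D) p x y.
  move=> /Qcov[x /= xD]; rewrite -ball_normE /ball_ /= => xy.
  rewrite (big_rem x)//= ltr_pwDl ?sumr_ge0//.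
  by rewrite lt_max subr_gt0 xy orbT.
have cvg_big (Y : normedModType R) (F : X -> X -> Y) y :
    (forall x, continuous (F x)) ->
    \sum_(x <- D) F x z @[z --> y] --> \sum_(x <- D) F x y.
  by move=> Fc; apply: cvg_big => [|x _]; [exact: add_continuous|exact: Fc].
(* Off [Q] all tents may vanish; the distance to [Q] then keeps the denominator positive, and it
   contributes nothing on [Q]. *)
pose den y := infdist Q y + \sum_(x <- D) p x y.
exists (fun y => (den y)^-1 *: \sum_(x <- D) p x y *: v x); split.
  move=> y; have [D0|D0] := eqVneq (den y) 0; last first.
    apply: cvgZ; last first.
      apply: (cvg_big _ (fun x z => p x z *: v x)) => x z.
      by apply: cvgZr_tmp; exact: p_cont.
    apply: cvgV => //; apply: cvgD; first exact: infdist_continuous.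
    exact: cvg_big.
  exfalso; have [/sum_gt0|nQy] := pselect (Q y).
    by move: D0; rewrite /den => D0; have := infdist_ge0 Q y; lra.
  have := infdist_gt0 (compact_closed (@norm_hausdorff _ _) cQ) Q0 nQy.
  by move: D0; rewrite /den; have := sum_ge0 y; lra.
move=> y C Qy cC Cv; rewrite /den infdist0// add0r.
apply: segment_closed_mean => // [x xD pxy|]; last exact: sum_gt0.
apply: Cv; first exact: DQ.
have [_] := rU _ (DQ _ xD); apply; move: pxy.
by rewrite lt_max ltxx/= subr_gt0.
Qed.

End gluing.

(** * Linking for maps defined on [Q] only *)

Section links.
Context {R : realType} {X : normedModType R}.

Lemma segment_closed_closed_ball (c : X) (e : R) :
  segment_closed [set z | `|z - c| <= e].
Proof.
move=> a b t /= ac bc /andP[t0 t1].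
have -> : t *: a + (1 - t) *: b - c = t *: (a - c) + (1 - t) *: (b - c).
  by rewrite !scalerBr addrACA -opprD -scalerDl subrKC scale1r.
rewrite (le_trans (ler_normD _ _))// !normrZ !ger0_norm ?subr_ge0//.
rewrite (_ : e = t * e + (1 - t) * e); last by rewrite -mulrDl subrKC mul1r.
by rewrite lerD// ler_wpM2l ?subr_ge0.
Qed.

(** A weak form of Dugundji's extension theorem: gluing the values of [h] over sets where [h] varies
    by at most [e / 2] gives a map on all of [X], exact on [B] and uniformly close to [h] on [Q]. *)
Lemma approximate_extension (Q B : set X) (h : X -> X) (e : R) :
    compact Q -> B `<=` Q -> {within Q, continuous h} ->
    (forall x, B x -> h x = 0) -> 0 < e ->
  exists k : X -> X, [/\ continuous k, forall x, B x -> k x = 0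
    & forall x, Q x -> `|k x - h x| <= e].
Proof.
move=> cQ BQ /subspace_continuousP hc h0 e0.
pose U x y := Q y -> `|h y - h x| <= e / 2.
(* Small values of h are replaced by 0, so that the extension vanishes on B. *)
pose v x := if `|h x| <= e / 2 then 0 else h x.
have e20 : 0 < e / 2 by rewrite divr_gt0.
have [x Qx|k [kc kP]] := compact_gluing (U := U) v cQ.
  move/cvgrPdist_le: (hc x Qx) => /(_ _ e20); rewrite near_withinE.
  by apply: filterS => y xy Qy; rewrite distrC; exact: xy.
exists k; split => // [y By|y Qy].
  apply: (kP _ [set 0] (BQ _ By)) => [a b t -> -> _|x Qx Uxy].
    by rewrite !scaler0 addr0.
  by have := Uxy (BQ _ By); rewrite /v /= (h0 _ By) sub0r normrN => ->.
have := kP _ _ Qy (@segment_closed_closed_ball (h y) e); apply.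
move=> x Qx /(_ Qy) xy.
rewrite /= /v; case: ifPn => [hx|_].
  rewrite sub0r normrN -(subrK (h x) (h y)) (le_trans (ler_normD _ _))//.
  by rewrite [leRHS]splitr lerD.
by rewrite distrC; lra.
Qed.

(** Linking speaks of maps on [X], the minimax of maps on [Q]. If [g] missed [S] on [Q], compactness
    would give a distance [d > 0] from the image to [S]. Extending [g - id] up to [d / 2], with
    value 0 on the boundary, yields a map of [X] that fixes the boundary and still misses [S]. *)
Lemma links_within (Q S : set X) (g : X -> X) :
    compact Q -> closed S -> links S Q -> {within Q, continuous g} ->
    (forall x, relative_boundary Q x -> g x = x) ->
  exists x, Q x /\ S (g x).
Proof.
move=> cQ clS [_ linkSQ] gc gid; apply: contrapT => nex.
have clQ : closed Q by apply: compact_closed cQ; exact: norm_hausdorff.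
(* Linking applied to the identity shows that [Q] and [S] are nonempty. *)
have [s [[q Qq _] Ss]] : (id @` Q) `&` S !=set0.
  by apply: linkSQ => // x; exact: cvg_id.
have S0 : S !=set0 by exists s.
have [|//|x0 /set_mem Qx0 min0] :=
    @compact_EVT_min X R (fun x => infdist S (g x)) Q _ cQ.
- by exists q.
- apply/subspace_continuousP => x Qx.
  have gx : g y @[y --> within Q (nbhs x)] --> g x.
    by move/subspace_continuousP: gc; exact.
  exact: (continuous_cvg _ (@infdist_continuous _ _ S (g x)) gx).
set d := infdist S (g x0) in min0.
have d0 : 0 < d by apply: infdist_gt0 => // Sg; apply: nex; exists x0.
have bQ : relative_boundary Q `<=` Q.
  by move=> x [/clQ].
have hc : {within Q, continuous (fun x => g x - x)}.
  apply/subspace_continuousP => x Qx; apply: cvgB.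
    by move/subspace_continuousP: gc; exact.
  by apply: cvg_within_filter; exact: cvg_id.
have [|k [kc k0 kh]] :=
    approximate_extension cQ bQ hc _ (divr_gt0 d0 (ltr0Sn R 1)).
  by move=> x bx; rewrite gid// subrr.
have [_ [[x Qx <-] Sx]] : ((fun x => x + k x) @` Q) `&` S !=set0.
  apply: linkSQ => [x|x bx]; first by apply: cvgD; [exact: cvg_id|exact: kc].
  by rewrite k0// addr0.
have := min0 x (mem_set Qx); apply/negP; rewrite -ltNge.
rewrite (le_lt_trans (infdist_le _ Sx))// opprD addrA distrC.
by rewrite (le_lt_trans (kh x Qx))// ltr_pdivrMr// ltr_pMr// ltr1n.
Qed.

(** The relative interior is open in [Q]: boundary points close enough to one of its points would be
    relatively interior too. *)
Lemma closed_relative_boundary (Q : set X) :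
  closed Q -> closed (relative_boundary Q).
Proof.
move=> clQ x clx.
have Qx : closure Q x.
  by apply: closed_closure => V /clx[y [[Qy _] Vy]]; exists y.
split => // -[_]; rewrite /within/= => nQ.
have [y [[Qy nQy] nQ']] := clx _ (nbhs_interior nQ).
by apply: nQy; split => //; exact: clQ.
Qed.

End links.

(** * Dual norm and descent along a direction *)

Section differential.
Context {R : realType} {X : normedModType R}.
Implicit Type f : X -> R.

Lemma dual_norm_leP (l : {linear X -> R}) (m : R) : 0 <= m ->
  (dual_norm l <= m%:E)%E <-> forall h, `|l h| <= m * `|h|.
Proof.
move=> m0; split => [lm h|lm].
  have [->|h0] := eqVneq h 0; first by rewrite linear0 !normr0 mulr0.
  have hpos : 0 < `|h| by rewrite normr_gt0.
  rewrite -ler_pdivrMr// -lee_fin (le_trans _ lm)//.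
  apply: ereal_sup_ubound => /=; exists (`|h|^-1 *: h).
    by rewrite /= normrZ normfV normr_id mulVf ?gt_eqF.
  by rewrite linearZ normrM normfV normr_id mulrC.
apply: ge_ereal_sup => _ [h /= h1 <-]; rewrite lee_fin (le_trans (lm h))//.
by rewrite ler_piMr.
Qed.

(** Homogeneity, and the one-sided bound applied to both [h] and [- h]. *)
Lemma linear_norm_le (l : {linear X -> R}) (m : R) :
  (forall h, `|h| <= 1 -> l h <= m) -> forall h, `|l h| <= m * `|h|.
Proof.
move=> lm h; have [->|h0] := eqVneq h 0; first by rewrite linear0 !normr0 mulr0.
have hpos : 0 < `|h| by rewrite normr_gt0.
have le_h u : `|u| = `|h| -> l u <= m * `|h|.
  move=> uh; rewrite -ler_pdivrMr// mulrC.
  have -> : `|h|^-1 * l u = l (`|h|^-1 *: u) by rewrite linearZ.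
  by apply: lm; rewrite normrZ normfV normr_id uh mulVf ?gt_eqF.
by rewrite ler_norml lerNl -linearN !le_h ?normrN.
Qed.

Lemma C1_continuous f : C1_functional f -> continuous f.
Proof. by move=> [df _] x; exact: differentiable_continuous. Qed.

Lemma C1_near f x (e : R) : C1_functional f -> 0 < e ->
  \forall y \near x, forall h, `|'d f y h - 'd f x h| <= e * `|h|.
Proof.
move=> [_ /(_ x) fC] e0.
have : \forall y \near x, (dual_norm ('d f y \- 'd f x)%R < e%:E)%E.
  exact: fC _ (@nbhs_open_ereal_lt R 0 (fun=> e) e0).
apply: filterS => y /ltW dyx.
exact: (iffLR (@dual_norm_leP ('d f y \- 'd f x) e (ltW e0)) dyx).
Qed.

Lemma is_derive_line f (p w : X) (s : R) :
  differentiable f (p - s *: w) ->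
  is_derive s (1 : R) (fun t : R => f (p - t *: w)) (- 'd f (p - s *: w) w).
Proof.
move=> df; have dD := @diff_derivable _ _ _ _ _ (- w) df.
have E : (fun h : R =>
      h^-1 *: (f (p - (h *: (1 : R) + s) *: w) - f (p - s *: w)))
    = fun h => h^-1 *: (f (h *: (- w) + (p - s *: w)) - f (p - s *: w)).
  apply/funext => h; congr (_ *: (f _ - _)).
  by rewrite scalerN addrCA -opprD -scalerDl [h *: 1]mulr1.
split; first by rewrite /derivable E.
rewrite /derive E; have := deriveE (- w) df; rewrite /derive => ->.
by rewrite linearN.
Qed.

(** The mean value theorem on the segment from [p] to [p - t *: w]. The excess [eta] is spent in
    halves: one on replacing [w0] by [w], one on moving the differential from [p0] to the
    intermediate point. One [r] serves all [p], [w], [t], as the compactness argument for paths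
    requires. *)
Lemma C1_descent f (p0 w0 : X) (mu : R) : C1_functional f -> mu < 'd f p0 w0 ->
  exists2 r : R, 0 < r & forall p w t,
    `|p - p0| < r -> `|w - w0| < r -> 0 < t < r ->
    f (p - t *: w) < f p - t * mu.
Proof.
move=> fC mu0; set eta := 'd f p0 w0 - mu.
have eta0 : 0 < eta by rewrite subr_gt0.
have W0 : 0 < `|w0| + 1 by rewrite ltr_pwDr.
have [r1 /= r10 r1P] : exists2 r1 : R, 0 < r1 & forall x, `|x - p0| < r1 ->
    forall h, `|'d f x h - 'd f p0 h| <= eta / 2 / (`|w0| + 1) * `|h|.
  have /nbhs_ballP[r1 /= r10 r1P] :=
    C1_near p0 fC (divr_gt0 (divr_gt0 eta0 (ltr0Sn R 1)) W0).
  by exists r1 => // x xp; apply: r1P; rewrite -ball_normE /= distrC.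
have [r2 /= r20 r2P] : exists2 r2 : R, 0 < r2 & forall w, `|w - w0| < r2 ->
    mu + eta / 2 < 'd f p0 w.
  have dc : {for w0, continuous ('d f p0)} by apply: diff_continuous; case: fC.
  have : mu + eta / 2 < 'd f p0 w0 by rewrite /eta; lra.
  move=> /(cvgr_gt _ dc)/nbhs_ballP[r2 /= r20 r2P].
  by exists r2 => // w ww0; apply: r2P; rewrite -ball_normE /= distrC.
(* The bound 1 gives [|w| <= |w0| + 1]; then [|p - p0| + t * |w|] stays below [r1], whence the
   divisor [|w0| + 2]. *)
exists (Num.min (Num.min 1 r2) (r1 / (`|w0| + 2))).
  by rewrite !lt_min ltr01 r20/= divr_gt0// ltr_pwDr.
move=> p w t; rewrite !lt_min => /andP[_ pp0] /andP[/andP[w1 w2] _].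
move=> /andP[t0 /andP[_ tr]].
have wW : `|w| <= `|w0| + 1.
  by rewrite -(subrK w0 w) addrC (le_trans (ler_normD _ _))// lerD2l ltW.
have fdiff : forall x, differentiable f x by case: fC.
have [|c] := @MVT R _ (fun s => - 'd f (p - s *: w) w) 0 t t0
    (fun s _ => is_derive_line (fdiff _)).
  apply: derivable_within_continuous => s _.
  by have [] := is_derive_line (fdiff (p - s *: w)).
rewrite in_itv/= => /andP[c0 ct].
rewrite scale0r !subr0 => E.
have cr : `|p - c *: w - p0| < r1.
  rewrite addrAC (le_lt_trans (ler_normB _ _))// normrZ gtr0_norm//.
  have : c * `|w| <= t * (`|w0| + 1) by rewrite ler_pM// ltW.
  have W2 : 0 < `|w0| + 2 by rewrite ltr_pwDr.
  move: pp0 tr; rewrite !ltr_pdivlMr// => pp0 tr cw; nra.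
have := r1P _ cr w; have := r2P _ w2 => dw.
have : eta / 2 / (`|w0| + 1) * `|w| <= eta / 2.
  by rewrite mulrAC ler_pdivrMr// ler_wpM2l ?divr_ge0// ltW.
move=> etaw /le_trans/(_ etaw); rewrite ler_norml => /andP[dw' _].
have : mu < 'd f (p - c *: w) w by lra.
rewrite -subr_gt0 => pos.
rewrite -subr_gt0; have := mulr_gt0 t0 pos; move: E => /eqP.
rewrite subr_eq => /eqP ->; nra.
Qed.

End differential.

(** * Lowering the level of a path *)

Section descent.
Context {R : realType} {X : normedModType R}.

(** Steep directions at the high points and 0 elsewhere are glued into a field [W] of norm at most
    1, zero on [Z]. Along [g - t W], near a high point [f] drops by more than [(a + lam) * t] while
    [psi] gains at most [a * t]; elsewhere the slack below [M] absorbs a small [t]. Compactness of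
    [Q] makes [t] uniform. *)
Lemma minimax_descent (Q Z : set X) (f psi : X -> R) (g : X -> X)
    (a lam M : R) :
    compact Q -> {within Q, continuous g} -> C1_functional f ->
    0 <= a -> 0 < lam -> (forall x y, `|psi x - psi y| <= a * `|x - y|) ->
    (forall x, Q x -> f (g x) + psi (g x) <= M) ->
    (forall x, Q x -> M <= f (g x) + psi (g x) ->
       (exists2 w, `|w| <= 1 & a + lam < 'd f (g x) w) /\
       \forall y \near within Q (nbhs x), ~ Z y) ->
  exists t k, [/\ 0 < t, {within Q, continuous k},
    forall x, Q x -> Z x -> k x = g x, forall x, Q x -> `|k x - g x| <= t
    & forall x, Q x -> f (k x) + psi (k x) <= M - lam * t].
Proof.
move=> cQ /subspace_continuousP gc fC a0 lam0 psiL gM steep.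
pose Phi x := f x + psi x.
have Phic : continuous Phi.
  move=> x; apply: cvgD; first exact: C1_continuous.
  have a1 : 0 < a + 1 by rewrite ltr_pwDr.
  apply/cvgrPdist_lt => e e0; near=> y.
  apply: le_lt_trans (psiL _ _) _.
  apply: (@le_lt_trans _ _ ((a + 1) * `|x - y|)).
    by rewrite ler_wpM2r ?normr_ge0// lerDl.
  rewrite mulrC -ltr_pdivlMr//; near: y; apply: cvgr_dist_lt => //.
  by rewrite divr_gt0.
pose A x := Q x /\ M <= Phi (g x).
have /choice[w wP] : forall x, exists w, A x ->
    `|w| <= 1 /\ a + lam < 'd f (g x) w.
  move=> x; have [[Qx Mx]|nA] := pselect (A x); last by exists 0.
  by have [[w w1 dw] _] := steep _ Qx Mx; exists w => _.
pose v x := if pselect (A x) then w x else 0.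
(* Near a high [x] the direction [w x] stays steep and [Z] is avoided; near a low [x] there are no
   high points, so the direction 0 never enters the mean at a high point. *)
pose U x y := Q y ->
  (A x -> ~ Z y /\ a + lam < 'd f (g y) (w x)) /\ (~ A x -> ~ A y).
have nU x : Q x -> nbhs x (U x).
  move=> Qx; have [Ax|nAx] := pselect (A x); last first.
    have Mx : Phi (g x) < M.
      by rewrite ltNge; apply/negP => Mx; apply: nAx.
    have : \forall y \near within Q (nbhs x), Phi (g y) < M.
      exact: cvgr_lt (continuous_cvg _ (Phic (g x)) (gc _ Qx)) _ Mx.
    rewrite near_withinE; apply: filterS => y yM Qy; split => // _ [_].
    by apply/negP; rewrite -ltNge yM.
  have [w1 dw] := wP _ Ax.
  have d0 : 0 < ('d f (g x) (w x) - (a + lam)) / 2.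
    by rewrite divr_gt0// subr_gt0.
  have : \forall y \near within Q (nbhs x), forall h,
      `|'d f (g y) h - 'd f (g x) h| <=
      ('d f (g x) (w x) - (a + lam)) / 2 * `|h|.
    exact: (gc _ Qx _ (C1_near (g x) fC d0)).
  have [_] := steep _ Qx Ax.2; rewrite !near_withinE => near2 near1.
  near=> y => Qy; split => // _; split.
    by move: Qy; near: y; exact: near2.
  have : Q y -> forall h, `|'d f (g y) h - 'd f (g x) h| <=
      ('d f (g x) (w x) - (a + lam)) / 2 * `|h| by near: y; exact: near1.
  move=> /(_ Qy (w x)).
  rewrite ler_norml => /andP[dy _].
  have : ('d f (g x) (w x) - (a + lam)) / 2 * `|w x| <=
      ('d f (g x) (w x) - (a + lam)) / 2 by rewrite ler_piMr// ltW.
  by move: dy dw; lra.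
have [W [Wc WP]] := compact_gluing v cQ nU.
have W1 y : Q y -> `|W y| <= 1.
  move=> Qy.
  suff : [set z | `|z - 0| <= 1] (W y) by rewrite /= subr0.
  apply: (WP y _ Qy) => [|x Qx Uxy]; first exact: segment_closed_closed_ball.
  rewrite /= subr0 /v.
  by case: pselect => [Ax|nAx] /=; [have [] := wP _ Ax|rewrite normr0 ler01].
have WZ y : Q y -> Z y -> W y = 0.
  move=> Qy Zy; apply: (WP _ [set 0] Qy) => [u u' t -> -> _|x Qx Uxy].
    by rewrite !scaler0 addr0.
  by rewrite /v /=; case: pselect => //= Ax; have [/(_ Ax)[]] := Uxy Qy.
have WA y : A y -> a + lam < 'd f (g y) (W y).
  move=> Ay; have Qy := Ay.1.
  apply: (WP _ [set z | a + lam < 'd f (g y) z] Qy) => [u u' t /= up u'p|x Qx].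
    move=> /andP[t0 t1].
    have -> : 'd f (g y) (t *: u + (1 - t) *: u') =
        t * 'd f (g y) u + (1 - t) * 'd f (g y) u'.
      by rewrite linearD !linearZ.
    have [->|tn0] := eqVneq t 0; first by rewrite subr0 mul0r mul1r add0r.
    have tp : 0 < t by rewrite lt_neqAle eq_sym tn0.
    nra.
  move=> /(_ Qy)[Ax nAx]; rewrite /= /v; case: pselect => [Ax'|nAx'] /=.
    by have [] := Ax Ax'.
  by have := nAx nAx'.
have : \forall t \near 0^'+, Q `<=`
    [set x | Phi (g x - t *: W x) <= M - lam * t].
  have /compact_near_coveringP/near_covering_withinP cov := cQ.
  apply: cov => x Qx.
  have gx := gc _ Qx.
  have [Ax|nAx] := pselect (A x).
    have [r r0 rP] := C1_descent fC (WA _ Ax).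
    have Wx : \forall y \near x, `|W x - W y| < r.
      by move/cvgrPdist_lt: (Wc x); apply.
    move/cvgrPdist_lt: gx => /(_ _ r0); rewrite near_withinE => gx.
    exists ([set y | (Q y -> `|g x - g y| < r) /\ `|W x - W y| < r],
            [set t | 0 < t < r]) => /=.
      split; first exact: filterI gx Wx.
      by near=> t; apply/andP; split; near: t;
        [exact: nbhs_right_gt|exact: nbhs_right_lt].
    move=> [y t] /= [[gy Wy] tr] Qy; move: gy => /(_ Qy) gy.
    have := rP (g y) (W y) t; rewrite distrC => /(_ gy).
    rewrite distrC => /(_ Wy tr) fdec.
    have := psiL (g y - t *: W y) (g y).
    rewrite addrAC subrr add0r normrN normrZ ler_norml => /andP[_].
    case/andP: tr => t0 _; rewrite gtr0_norm//.
    have : a * (t * `|W y|) <= a * t by rewrite ler_wpM2l// ler_piMr ?W1// ltW.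
    by have := gM _ Qy; rewrite /Phi; nra.
  have Mx : Phi (g x) < M.
    by rewrite ltNge; apply/negP => Mx; apply: nAx.
  (* Half of the slack pays for the displacement, the other half for [lam * t], since
     [t < e / lam]. *)
  pose e := (M - Phi (g x)) / 2.
  have e0 : 0 < e by rewrite divr_gt0// subr_gt0.
  have [rho rho0 rhoP] : exists2 rho : R, 0 < rho &
      forall p, `|p - g x| < rho -> Phi p < M - e.
    have : Phi (g x) < M - e by rewrite /e; lra.
    move=> /(cvgr_lt _ (Phic (g x)))/nbhs_ballP[rho /= rho0 rhoP].
    by exists rho => // p px; apply: rhoP; rewrite -ball_normE /= distrC.
  have rho20 : 0 < rho / 2 by rewrite divr_gt0.
  move/cvgrPdist_lt: gx => /(_ _ rho20); rewrite near_withinE => gx.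
  exists ([set y | Q y -> `|g x - g y| < rho / 2],
          [set t | [/\ 0 < t, t < rho / 2 & t < e / lam]]) => /=.
    split; first exact: gx.
    near=> t; split; near: t; first exact: nbhs_right_gt.
      exact: nbhs_right_lt.
    by apply: nbhs_right_lt; rewrite divr_gt0.
  move=> [y t] /= [gy [t0 trho]] + Qy; move: gy => /(_ Qy) gy.
  rewrite ltr_pdivlMr// => te.
  apply: (@le_trans _ _ (M - e)); last by rewrite lerD2l lerN2 mulrC ltW.
  apply/ltW/rhoP; rewrite addrAC (le_lt_trans (ler_normB _ _))// distrC.
  rewrite [rho]splitr ltrD// normrZ gtr0_norm// (le_lt_trans _ trho)//.
  by rewrite ler_piMr ?W1// ltW.
move=> Qdec; near (0 : R)^'+ => t.
have t0 : 0 < t by near: t; exact: nbhs_right_gt.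
exists t, (fun x => g x - t *: W x); split => //.
- apply/subspace_continuousP => x Qx; apply: cvgB; first exact: gc.
  by apply: cvg_within_filter; apply: cvgZl_tmp; exact: Wc.
- by move=> x Qx Zx; rewrite WZ// scaler0 subr0.
- move=> x Qx; rewrite addrAC subrr add0r normrN normrZ gtr0_norm//.
  by rewrite ler_piMr ?W1// ltW.
- by move=> x Qx; have /(_ _ Qx) : Q `<=`
    [set x | Phi (g x - t *: W x) <= M - lam * t] by near: t; exact: Qdec.
Unshelve. all: by end_near. Qed.

End descent.

(* The ordering principle behind Ekeland's variational principle. *)
Lemma brezis_browder (R : realType) (T : Type) (E : set T)
    (le : T -> T -> Prop) (m : T -> R) (b : R) (x0 : T) :
    (forall x, le x x) -> (forall y x z, le x y -> le y z -> le x z) ->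
    (forall x y, le y x -> m y <= m x) -> (forall x, E x -> b <= m x) ->
    (forall u : nat -> T, (forall n, E (u n)) ->
       (forall i j, (i <= j)%N -> le (u j) (u i)) ->
       exists v, E v /\ forall n, le v (u n)) ->
    E x0 ->
  exists v, [/\ E v, le v x0 & forall y, E y -> le y v -> m v <= m y].
Proof.
move=> le_refl le_trans m_mono m_bnd low Ex0.
(* From [x] at stage [n], [s] chooses an element below [x] that minimizes [m] there up to
   [1 / (n + 1)]; iteration gives a decreasing sequence. *)
have /choice[s sP] : forall xn : T * nat, exists y, E xn.1 ->
    [/\ E y, le y xn.1 &
        forall z, E z -> le z xn.1 -> m y <= m z + xn.2.+1%:R^-1].
  move=> [x n] /=; have [Ex|nEx] := pselect (E x); last by exists x.
  pose V := [set m z | z in [set z | E z /\ le z x]].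
  have V0 : V !=set0 by exists (m x), x.
  have Vb : lbound V b by move=> _ [z [Ez _] <-]; exact: m_bnd.
  have n0 : (0 : R) < n.+1%:R^-1 by rewrite invr_gt0 ltr0n.
  have [|_ [y [Ey yx] <-] yV] := inf_adherent n0 (_ : has_inf V).
    by split => //; exists b.
  exists y => _; split => // z Ez zx.
  rewrite (Order.POrderTheory.le_trans (ltW yV))//.
  by rewrite lerD2r; apply: ge_inf; [exists b|exists z].
pose u := fix u n := if n is k.+1 then s (u k, k) else x0.
have Eu n : E (u n).
  by elim: n => //= n IH; have [] := sP (u n, n) IH.
have uS n : le (u n.+1) (u n) by have [] := sP (u n, n) (Eu n).
have [|v [Ev vu]] := low u Eu.
  move=> i j /subnK <-; elim: (j - i)%N => // k IH.
  exact: le_trans (uS _) IH.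
exists v; split => //; first exact: (vu 0%N).
move=> y Ey yv; apply/ler_addgt0Pr => e e0.
(* Anything below [v] competes at every stage, hence [m v <= m (u n.+1) <= m y + 1 / (n + 1)]. *)
near \oo => n.
have [_ _ /(_ y Ey)] := sP (u n, n) (Eu n).
move=> /(_ (le_trans _ _ _ yv (vu n))) /= un.
apply: (Order.POrderTheory.le_trans (m_mono _ _ (vu n.+1))).
apply: (Order.POrderTheory.le_trans un); rewrite lerD2l ltW//.
by near: n; exact: near_infty_natSinv_lt (PosNum e0).
Unshelve. all: by end_near. Qed.

(** * Almost critical points near a set met by all paths *)

(** An abstract closed [T] that every path meets covers both [S] itself and a superlevel set of
    [f]. *)
Lemma located_almost_critical (R : realType) (X : completeNormedModType R)
    (Q B T : set X) (f : X -> R) (c : R) :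
    compact Q -> B `<=` Q -> closed B -> closed T -> B `&` T = set0 ->
    C1_functional f ->
    (forall x, B x -> f x <= c) -> (forall x, T x -> c <= f x) ->
    (forall g : X -> X, {within Q, continuous g} ->
       (forall x, B x -> g x = x) -> exists x, Q x /\ T (g x)) ->
    (forall s : R, 0 < s -> exists g : X -> X, [/\ {within Q, continuous g},
       forall x, B x -> g x = x & forall x, Q x -> f (g x) <= c + s]) ->
  forall eps : R, 0 < eps ->
  exists x, [/\ c <= f x, f x <= c + 5 / 4 * eps ^+ 2,
    exists2 y, T y & `|x - y| < 3 / 2 * eps
    & forall h, `|'d f x h| <= eps / 2 * `|h|].
Proof.
move=> cQ BQ clB clT BT0 fC fB fT hitT approx eps eps0.
(* With this value the slope threshold [a + a] is [eps / 2]. *)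
pose a := eps / 4; have a0 : 0 < a by rewrite divr_gt0.
(* The initial level exceeds the lower bound [c + a ^+ 2] by [a ^+ 2 / 2]; at cost [a] per unit
   length, paths below [g0] in the order move by at most [a / 2]. *)
have s0 : 0 < a ^+ 2 / 2 by rewrite divr_gt0// exprn_gt0.
have [g0 [g0c g0B g0s]] := approx _ s0.
have [q [Qq Tq]] := hitT _ g0c g0B.
have T0 : T !=set0 by exists (g0 q).
pose psi x := Num.max 0 (a * (a - infdist T x)).
have psi_ge0 x : 0 <= psi x by rewrite le_max lexx.
have psi_le x : psi x <= a ^+ 2.
  by rewrite ge_max sqr_ge0/=; have := infdist_ge0 T x; nra.
have psiL x y : `|psi x - psi y| <= a * `|x - y|.
  have : `|a * (a - infdist T x) - a * (a - infdist T y)| <= a * `|x - y|.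
    rewrite -mulrBr normrM gtr0_norm// ler_pM2l// opprB addrC addrA subrK.
    by rewrite distrC infdist_lipschitz.
  rewrite /psi; set u := a * _; set u' := a * _; rewrite !ler_norml.
  by move=> /andP[? ?]; rewrite /Num.max; case: ifPn; case: ifPn;
    rewrite -?leNgt => ? ?; apply/andP; split; lra.
(* Paths stay frozen where g0 is far from T; this forces the high points of
   nearby paths to lie close to T. *)
pose Z x := B x \/ Q x /\ a <= infdist T (g0 x).
pose E (p : (X -> X) * R) := [/\ {within Q, continuous p.1},
  forall x, Z x -> p.1 x = g0 x
  & forall x, Q x -> f (p.1 x) + psi (p.1 x) <= p.2].
(* Ekeland's order for the uniform distance on [Q]: moving a path must be paid for in level at rate
   [a]. *)
pose le (p p' : (X -> X) * R) :=
  forall x, Q x -> p.2 + a * `|p.1 x - p'.1 x| <= p'.2.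
have le_mono p p' : le p' p -> p'.2 <= p.2.
  by move=> /(_ _ Qq); apply: le_trans; rewrite lerDl mulr_ge0// ltW.
have le_trans_ p p1 p2 : le p1 p -> le p p2 -> le p1 p2.
  move=> p1p pp2 x Qx; have := p1p _ Qx; have := pp2 _ Qx.
  by have := ler_distD (p.1 x) (p1.1 x) (p2.1 x); nra.
have E_ge p : E p -> c + a ^+ 2 <= p.2.
  move=> [pc pZ pM]; have [|x [Qx Tx]] := hitT _ pc.
    by move=> x Bx; rewrite pZ ?g0B//; left.
  apply: le_trans (pM _ Qx); rewrite lerD ?fT// /psi infdist0// subr0 -expr2.
  by rewrite le_max lexx orbT.
have fc := C1_continuous fC.
have psic : continuous psi.
  move=> x; apply: (@continuous_max _ _ (fun=> 0)
      (fun x => a * (a - infdist T x))); first exact: cvg_cst.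
  apply: cvgM; first exact: cvg_cst.
  apply: cvgB; first exact: cvg_cst.
  exact: infdist_continuous.
(* The levels decrease to a limit, and the order turns level gaps into a uniform Cauchy estimate on
   [Q]; the limit path with the limit level is the lower bound. *)
have complete (u : nat -> (X -> X) * R) : (forall n, E (u n)) ->
    (forall i j, (i <= j)%N -> le (u j) (u i)) ->
    exists v, E v /\ forall n, le v (u n).
  move=> Eu leu.
  have mcvg : cvgn (fun n => (u n).2).
    apply: nonincreasing_is_cvgn; first by move=> i j /leu/le_mono.
    by exists (c + a ^+ 2) => _ [n _ <-]; exact: E_ge.
  set L := limn (fun n => (u n).2) in mcvg.
  have Lle n : L <= (u n).2.
    by apply: nonincreasing_cvgn_ge => // i j /leu/le_mono.
  have close x n i : Q x -> (n <= i)%N ->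
      `|(u i).1 x - (u n).1 x| <= ((u n).2 - L) / a.
    move=> Qx ni; have := leu _ _ ni x Qx; have := Lle i.
    by rewrite ler_pdivlMr//; nra.
  have small e : 0 < e -> exists n, ((u n).2 - L) / a < e.
    move=> e0; have ea0 : 0 < e * a by rewrite mulr_gt0.
    have /cvgrPdist_lt/(_ _ ea0)[n _ nP] := mcvg.
    exists n; rewrite ltr_pdivrMr//; apply: le_lt_trans (nP n (leqnn n)).
    by rewrite distrC ler_norm.
  have ucvg x : Q x -> cvgn (fun n => (u n).1 x).
    move=> Qx; apply/cauchy_cvgP/cauchy_exP => e e0.
    have [n ne] := small _ e0; exists ((u n).1 x); exists n => // i /= ni.
    rewrite -ball_normE /ball_/= distrC (le_lt_trans _ ne)//.
    exact: close.
  pose v x := limn (fun n => (u n).1 x).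
  have closev x n : Q x -> `|v x - (u n).1 x| <= ((u n).2 - L) / a.
    move=> Qx.
    have cv : `|(u i).1 x - (u n).1 x| @[i --> \oo] --> `|v x - (u n).1 x|.
      by apply: cvg_norm; apply: cvgB; [exact: ucvg|exact: cvg_cst].
    apply: (@closed_cvg _ _ _ _ _ (fun r => r <= ((u n).2 - L) / a) _ _ _ cv).
      exact: closed_le.
    by near=> i; apply: close => //; near: i; exact: nbhs_infty_ge.
  exists (v, L); split; last first.
    move=> n x Qx /=; have := closev x n Qx; rewrite ler_pdivlMr//; lra.
  split => /=.
  - apply/subspace_continuousP => x Qx; apply/cvgrPdist_lt => e e0.
    have e30 : 0 < e / 3 by rewrite divr_gt0.
    have [n ne] := small _ e30.
    have [/subspace_continuousP/(_ x Qx)/cvgrPdist_lt/(_ _ e30) + _ _] := Eu n.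
    rewrite !near_withinE; apply: filterS => y yP Qy.
    have Hxy : `|(u n).1 x - (u n).1 y| < e / 3 by exact: yP.
    have Hx := closev x n Qx; have := closev y n Qy; rewrite distrC => Hy.
    change (`|v x - v y| < e).
    have := ler_distD ((u n).1 x) (v x) (v y).
    have := ler_distD ((u n).1 y) ((u n).1 x) (v y).
    lra.
  - move=> x Zx; rewrite /v (_ : (fun n => _) = fun=> g0 x) ?lim_cst//.
    by apply/funext => n; have [_ ->] := Eu n.
  - move=> x Qx; have cv : f ((u n).1 x) + psi ((u n).1 x) @[n --> \oo] -->
        f (v x) + psi (v x).
      apply: cvgD.
        exact: (continuous_cvg _ (fc (v x)) (ucvg x Qx)).
      exact: (continuous_cvg _ (psic (v x)) (ucvg x Qx)).
    apply: (ler_cvg_to cv mcvg); near=> n.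
    by have [_ _] := Eu n; apply.
have E0 : E (g0, c + a ^+ 2 / 2 + a ^+ 2).
  by split => //= x Qx; rewrite lerD ?g0s ?psi_le.
have le_refl_ p : le p p by move=> x Qx; rewrite subrr normr0 mulr0 addr0.
have [[g M] [EgM gle gmin]] := brezis_browder le_refl_ le_trans_ le_mono E_ge
  complete E0.
have M_ge : c + a ^+ 2 <= M := E_ge _ EgM.
have [/= gc gZ gM] := EgM.
(* Without the desired point, every point of [Q] at level [M] is steep and away from [Z]; the
   descent lemma with [lam = a] then gives a pair strictly below the minimal [(g, M)]. *)
apply: contrapT => noncrit.
have [x Qx xM|t [k [t0 kc kZ kt kM]]] :=
    @minimax_descent R X Q Z f psi g a a M cQ gc fC (ltW a0) a0 psiL gM.
- have gQ y : Q y -> `|g y - g0 y| <= a / 2.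
    by move=> Qy; have := gle y Qy; rewrite /=; nra.
  (* On [B], [g] is the identity, [f <= c], and [psi < a ^+ 2] because the distance to [T] is
     positive: the level [M] is not reached. *)
  have nB : ~ B x.
    move=> Bx; have nTx : ~ T x by move=> Tx; rewrite -[False]/(set0 x) -BT0.
    have : 0 < infdist T x by exact: infdist_gt0.
    move: xM; rewrite gZ; [rewrite g0B//|by left].
    have := fB _ Bx; rewrite /psi /Num.max; case: ifPn => _; nra.
  (* Otherwise [g x = g0 x] with [psi = 0], and the level is at most [c + a ^+ 2 / 2 < M]. *)
  have near_T : infdist T (g0 x) < a.
    rewrite ltNge; apply/negP => far; move: xM; rewrite gZ; last by right.
    have -> : psi (g0 x) = 0.
      by apply/max_idPl; rewrite pmulr_rle0// subr_le0.
    by have := g0s _ Qx; lra.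
  split; last first.
    have gx0 : g0 y @[y --> within Q (nbhs x)] --> g0 x.
      by move/subspace_continuousP: g0c; exact.
    have nearT : \forall y \near within Q (nbhs x), infdist T (g0 y) < a.
      apply: (cvgr_lt _ _ _ near_T).
      exact: (continuous_cvg _ (@infdist_continuous _ _ T (g0 x)) gx0).
    have nearB : \forall y \near within Q (nbhs x), ~ B y.
      by apply: cvg_within; apply: open_nbhs_nbhs; split => //; rewrite openC.
    by apply: filterS2 nearT nearB => y yT yB [//|[_]]; rewrite leNgt yT.
  apply: contrapT => flat; apply: noncrit; exists (g x).
  have fle := gM _ Qx; have Mle := le_mono _ _ gle.
  have psi0 := psi_ge0 (g x); have psia := psi_le (g x).
  move: Mle; rewrite /= => Mle.
  (* From [c + a ^+ 2 <= M <= f + psi] and [psi <= a ^+ 2] comes [c <= f]; from [f <= M] comes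
     [f <= c + 3 / 2 * a ^+ 2]. The distance to [T] is below [a / 2 + a]. *)
  split.
  - lra.
  - have -> : eps = 4 * a by rewrite /a; lra.
    by have := sqr_ge0 a; lra.
  - have [y Ty yx] := infdist_lt T0 near_T; exists y => //.
    have := ler_distD (g0 x) (g x) y; have := gQ _ Qx.
    by move: yx; rewrite /a; lra.
  - apply: linear_norm_le => w w1; rewrite leNgt; apply/negP => steep.
    by apply: flat; exists w => //; rewrite (_ : a + a = eps / 2)// /a; lra.
have Ek : E (k, M - a * t).
  by split => //= x Zx; rewrite kZ ?gZ//; case: Zx => [/BQ|[]].
have : M <= M - a * t.
  by apply: (gmin _ Ek) => x Qx /=; have := kt _ Qx; nra.
by have := mulr_gt0 a0 t0; lra.
Unshelve. all: by end_near. Qed.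

(** * Passage to a sequence and the minimax theorem *)

Lemma almost_critical_sequence (R : realType) (X : normedModType R)
    (f : X -> R) (c : R) :
    (forall eps : R, 0 < eps -> exists x, [/\ c <= f x,
       f x <= c + 5 / 4 * eps ^+ 2 & forall h, `|'d f x h| <= eps / 2 * `|h|]) ->
  exists u : nat -> X, ((f (u n))%:E @[n --> \oo] --> c%:E) /\
    (dual_norm ('d f (u n)) @[n --> \oo] --> 0%E).
Proof.
move=> crit.
have /choice[u uP] : forall n, exists x, [/\ c <= f x,
    f x <= c + 5 / 4 * (@harmonic R n) ^+ 2 &
    forall h, `|'d f x h| <= harmonic n / 2 * `|h|].
  by move=> n; apply: crit; exact: harmonic_gt0.
have h0 n : 0 <= @harmonic R n by rewrite harmonic_ge0.
exists u; split.
  apply: cvg_EFin; first by near=> n.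
  have lim0 : c + 5 / 4 * (@harmonic R n * harmonic n) @[n --> \oo] --> c.
    rewrite -[X in _ --> X](_ : c + 5 / 4 * (0 * 0) = c); last first.
      by rewrite !mulr0 addr0.
    apply: cvgD; first exact: cvg_cst.
    apply: cvgM; first exact: cvg_cst.
    by apply: cvgM; exact: cvg_harmonic.
  apply: (squeeze_cvgr _ (cvg_cst c) lim0); near=> n => /=.
  by have [-> + _] := uP n; rewrite expr2.
have lim0 : (@harmonic R n / 2)%:E @[n --> \oo] --> 0%E.
  apply: cvg_EFin; first by near=> n.
  rewrite -[X in _ --> X](mul0r 2^-1); apply: cvgM; last exact: cvg_cst.
  exact: cvg_harmonic.
apply: (squeeze_cvge _ (cvg_cst 0%E) lim0); near=> n.
have [_ _ un] := uP n; apply/andP; split.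
  apply: ereal_sup_ubound; exists 0; first by rewrite /= normr0.
  by rewrite linear0 normr0.
by apply/dual_norm_leP => //; rewrite divr_ge0.
Unshelve. all: by end_near. Qed.

Theorem theorem7 (R : realType) (X : completeNormedModType R)
    (Q S : set X) (f : X -> R)
    (compactQ : compact Q) (dQ_neq0 : relative_boundary Q !=set0)
    (closedS : closed S) (linkSQ : links S Q) (C1f : C1_functional f)
    (c0_ge_d : (sup_on f (relative_boundary Q) <= inf_on f S)%E) :
  let c := minimax f Q in
  let c0 := inf_on f S in
  (exists u : nat -> X,
     ((f (u n))%:E @[n --> \oo] --> c) /\
     (dual_norm ('d f (u n)) @[n --> \oo] --> 0%E)) /\
  (c = c0 ->
   forall eps : R, 0 < eps ->
     (eps%:E < Order.max 1 (set_dist (relative_boundary Q) S) * (2^-1)%:E)%E ->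
     exists x : X,
       [/\ (c <= (f x)%:E)%E /\ ((f x)%:E <= c + (5 / 4 * eps ^+ 2)%:E)%E,
           (edist_inf S x <= (3 / 2 * eps)%:E)%E
         & (dual_norm ('d f x) <= (eps / 2)%:E)%E]).
Proof.
move=> c c0.
have clQ : closed Q by apply: compact_closed compactQ; exact: norm_hausdorff.
have bQ : relative_boundary Q `<=` Q by move=> x [/clQ].
have fc := C1_continuous C1f.
have Q0 : Q !=set0 by case: dQ_neq0 => x /bQ Qx; exists x.
have fb x : relative_boundary Q x -> ((f x)%:E <= c0)%E.
  by move=> bx; apply: le_trans c0_ge_d; apply: ereal_sup_ubound; exists x.
have fS x : S x -> (c0 <= (f x)%:E)%E.
  by move=> Sx; apply: ereal_inf_lbound; exists x.
have attained (g : X -> X) : {within Q, continuous g} -> exists2 x, Q x &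
    forall y, Q y -> f (g y) <= f (g x).
  move=> /subspace_continuousP gc.
  have fgc : {within Q, continuous (fun y => f (g y))}.
    apply/subspace_continuousP => x Qx.
    exact: (continuous_cvg _ (fc (g x)) (gc x Qx)).
  have [x /set_mem Qx xmax] := compact_EVT_max Q0 compactQ fgc.
  by exists x => // y /mem_set /xmax.
have c0_le_c : (c0 <= c)%E.
  apply: le_ereal_inf_tmp => _ [g [gc gb] <-].
  have [x [Qx Sx]] := links_within compactQ closedS linkSQ gc gb.
  by apply: le_trans (fS _ Sx) _; apply: ereal_sup_ubound; exists x.
(* A boundary value of [f] bounds [c] from below through [c0]; the identity is an admissible path
   bounding it from above. *)
have c_fin : c \is a fin_num.
  rewrite fin_numE; apply/andP; split.
    have [b bb] := dQ_neq0; rewrite -ltNye.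
    exact: (lt_le_trans (ltNyr (f b)) (le_trans (fb _ bb) c0_le_c)).
  have idc : {within Q, continuous (@id X)}.
    apply/subspace_continuousP => x Qx.
    by apply: cvg_within_filter; exact: cvg_id.
  have [x Qx xmax] := attained _ idc.
  rewrite -ltey (le_lt_trans _ (ltry (f x)))//; apply: ge_ereal_inf.
  exists (sup_on (f \o id) Q); first by exists id.
  by apply: ge_ereal_sup => _ [y Qy <-]; rewrite lee_fin xmax.
have cE : c = (fine c)%:E by rewrite fineK.
have fbc x : relative_boundary Q x -> f x <= fine c.
  by move=> bx; rewrite -lee_fin -cE (le_trans (fb _ bx)).
have approx (s : R) : 0 < s -> exists g : X -> X,
    [/\ {within Q, continuous g}, forall x, relative_boundary Q x -> g x = x
      & forall x, Q x -> f (g x) <= fine c + s].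
  move=> s0; have : (c < (fine c + s)%:E)%E by rewrite cE lte_fin ltrDl.
  move=> /ereal_inf_lt[_ [g [gc gb] <-] gs]; exists g; split => // x Qx.
  rewrite -lee_fin (le_trans _ (ltW gs))//.
  by apply: ereal_sup_ubound; exists x.
(* The set [T] is left open here: it is [S] when [c = c0], and is chosen again for the sequence. *)
have critical := located_almost_critical compactQ bQ
  (closed_relative_boundary clQ) _ _ C1f fbc _ _ approx.
have SB : relative_boundary Q `&` S = set0 by rewrite setIC; case: linkSQ.
have fSc : c = c0 -> forall x, S x -> fine c <= f x.
  by move=> cc0 x Sx; rewrite -lee_fin -cE cc0 fS.
have hitS g := @links_within R X Q S g compactQ closedS linkSQ.
split => [|cc0 eps eps0 _]; last first.
  have [x [cx xc [y Sy xy] dx]] := critical _ closedS SB (fSc cc0) hitS _ eps0.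
  have eps2 : 0 <= eps / 2 by rewrite divr_ge0// ltW.
  exists x; split; last by apply/dual_norm_leP.
    by rewrite cE -EFinD !lee_fin.
  apply: ge_ereal_inf; exists (edist (x, y)); first by exists y.
  apply: edist_fin; first by rewrite mulr_gt0.
  by rewrite /= -ball_normE.
rewrite cE; apply: almost_critical_sequence => eps eps0.
suff [T [clT TB fT hitT]] : exists T : set X, [/\ closed T,
    relative_boundary Q `&` T = set0, forall x, T x -> fine c <= f x
  & forall g : X -> X, {within Q, continuous g} ->
      (forall x, relative_boundary Q x -> g x = x) -> exists x, Q x /\ T (g x)].
  have [x [cx xc _ dx]] := critical _ clT TB fT hitT _ eps0.
  by exists x.
have [cc0|c_neq_c0] := eqVneq c c0; first by exists S; split => //; exact: fSc.
(* When c0 < c the superlevel set {f >= c} is itself a linking set. *)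
have c0_lt_c : (c0 < c)%E by rewrite lt_neqAle eq_sym c_neq_c0.
exists [set x | fine c <= f x]; split => //.
- exact: (iffLR (continuous_closedP f) fc _ (@closed_ge R (fine c))).
- rewrite -subset0 => x [bx /=]; rewrite leNgt => /negP; apply.
  by rewrite -lte_fin -cE (le_lt_trans (fb _ bx)).
(* A maximum point of [f] along the path lies in the superlevel set, as [c] is the infimum of these
   maxima. *)
- move=> g gc gb; have [x Qx xmax] := attained _ gc; exists x; split => //=.
  rewrite -lee_fin -cE; apply: ge_ereal_inf.
  exists (sup_on (f \o g) Q); first by exists g.
  by apply: ge_ereal_sup => _ [y Qy <-]; rewrite lee_fin xmax.
Qed.
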